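(* Let $k \geq 2$ and $n \geq 1$ be integers. For any partial $k$-star decomposition $\mathcal{A}$ of $K_n$ there is a nonnegative integer $s$ such that $\mathcal{A}$ can be embedded in a $k$-star decomposition of $K_{n+s}$, where $s < \frac{9}{4}k$ if $k$ is odd and $s < (6-2\sqrt{2})k$ if $k$ is even.
   Context: All graphs are finite and simple. A $k$-star is a complete bipartite graph $K_{1,k}$. A $k$-star decomposition of a graph $G$ is a set of $k$-stars that are subgraphs of $G$ such that each edge of $G$ is in exactly one of the $k$-stars. A partial $k$-star decomposition of $G$ is a set (possibly empty) of $k$-stars that are subgraphs of $G$ such that each edge of $G$ is in at most one of the $k$-stars. An embedding of a partial $k$-star decomposition $\mathcal{A}$ of a graph $G$ is a partial $k$-star decomposition $\mathcal{B}$ of a graph $H$ such that $\mathcal{A} \subseteq \mathcal{B}$ and $G$ is a subgraph of $H$; we then say $\mathcal{A}$ is embedded in $\mathcal{B}$. $K_m$ denotes the complete graph on $m$ vertices. *)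

(* Defs.v *)
From HB Require Import structures.
From mathcomp Require Import all_boot all_order all_algebra finmap.
From mathcomp Require Import reals.

Set Implicit Arguments.
Unset Strict Implicit.
Unset Printing Implicit Defensive.

Local Open Scope fset_scope.

Definition fpairs (V : choiceType) (X : {fset V}) : {fset {fset V}} :=
  [fset e in fpowerset X | #|` e| == 2].

(* Finite simple graphs whose vertices are drawn from V, with edges given as
   two-element sets of vertices.  Vertices are not taken up to renaming, so
   the subgraph relation and sets of subgraphs are literal. *)
Record graph (V : choiceType) := Graph {
  graph_val : {fset V} * {fset {fset V}};
  graph_valP : graph_val.2 `<=` fpairs graph_val.1 }.

HB.instance Definition _ (V : choiceType) := [isSub for @graph_val V].
HB.instance Definition _ (V : choiceType) := [Choice of graph V by <:].

Definition vertices (V : choiceType) (G : graph V) : {fset V} :=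
  (graph_val G).1.

Definition edges (V : choiceType) (G : graph V) : {fset {fset V}} :=
  (graph_val G).2.

Definition subgraph (V : choiceType) (H G : graph V) : bool :=
  (vertices H `<=` vertices G) && (edges H `<=` edges G).

Definition complete (V : choiceType) (X : {fset V}) : graph V :=
  @Graph V (X, fpairs X) (fsubset_refl _).

(* The complete graph K_m on the vertex set {0, ..., m - 1}; in particular
   K_n is a subgraph of K_(n + s). *)
Definition complete_graph (m : nat) : graph nat :=
  complete [fset i in iota 0 m].

Definition is_complete_bipartite (V : choiceType) (p q : nat) (G : graph V) :
    Prop :=
  exists X Y : {fset V},
    [/\ [disjoint X & Y], #|` X| = p, #|` Y| = q,
        vertices G = X `|` Y
      & edges G = [fset [fset x; y] | x in X, y in Y]].

Definition is_star (V : choiceType) (k : nat) (S : graph V) : Prop :=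
  is_complete_bipartite 1 k S.

Definition star_subgraphs (V : choiceType) (k : nat) (G : graph V)
    (A : {fset graph V}) : Prop :=
  forall S, S \in A -> is_star k S /\ subgraph S G.

Definition star_decomposition (V : choiceType) (k : nat) (G : graph V)
    (A : {fset graph V}) : Prop :=
  star_subgraphs k G A /\
  forall e, e \in edges G -> exists! S, S \in A /\ e \in edges S.

Definition partial_star_decomposition (V : choiceType) (k : nat) (G : graph V)
    (A : {fset graph V}) : Prop :=
  star_subgraphs k G A /\
  forall e, e \in edges G ->
  forall S T, S \in A -> T \in A -> e \in edges S -> e \in edges T -> S = T.

Definition embedding (V : choiceType) (k : nat) (G : graph V)
    (A : {fset graph V}) (H : graph V) (B : {fset graph V}) : Prop :=
  [/\ partial_star_decomposition k G A, partial_star_decomposition k H B,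
      A `<=` B & subgraph G H].

(* Main.v *)
Require Import Defs.
From mathcomp Require Import all_boot all_order all_algebra finmap.
From mathcomp Require Import reals.
From mathcomp Require Import zify lra.

(** A graph has a k-star decomposition with c(x) stars centred at each vertex x
    exactly when it has an orientation with out-degrees k * c(x): direct each
    edge away from the centre of its star, and conversely cut the set of
    out-neighbours of each vertex into blocks of size k
    ([decomposition_of_orientation]). So let m = n + s and let D be the graph of
    the edges of K_m that are in no star of A. It has to be oriented with all
    out-degrees multiples of k. By [orientation_exact] an orientation with
    out-degrees k * c(x) exists as soon as the values k * c(x) add up to the
    number of edges and each vertex set T spans at most k * c(T) edges.

    The s new vertices are joined to everything. Spreading the stars centred at
    them as evenly as possible, a on p of them and a + 1 on the others, leaves
    by convexity three conditions about sets of old vertices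
    ([join_orientation]). Two of them say that, for some orientation of the
    leave of A in K_n with out-degrees o(x), the number r(x) = k * c(x) - o(x)
    of edges from x to the new vertices still to be directed away from x lies
    between 0 and s. The third one follows from
      sum over old x of min (r(x) / p) ((s - r(x)) / (s - p)) >= k - s / 2.
    A descent on c makes each term at least (s - k) / s
    ([greedy_orientation]), which is enough if s^2 <= 2 m (s - k). When m >= 4k
    this holds for all s between (4 - 2 sqrt 2) k and (4 + 2 sqrt 2) k.

    The number of edges of D has to be divisible by k, that is, k divides
    m (m - 1) / 2. This is so when 2k divides m, and for odd k when k divides
    m. So a suitable s exists in every window of 2k, respectively k,
    consecutive integers. Windows starting at (4 - 2 sqrt 2) k for even k and at
    5k / 4 for odd k give the two bounds.

    If n <= k, then A is empty and m = 2k works ([complete_orientation]). If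
    n > k, then m > 2k, hence m >= 4k for even k and m >= 3k for odd k. The
    case m = 3k, k odd, is not covered by the descent. There n < 2k, so every
    vertex is the centre of at most one star of A and the other old vertices
    span a clique of D ([few_stars_on_few_vertices]); this bounds the number of
    stars of A and gives |D| >= k * m. Thus every vertex can be given a star.
    Up to k (m + s) edges, the additional stars are centred at new vertices
    ([sparse_leave_orientation]). Beyond that A has fewer than k / 4 stars, and
    the surplus is centred at old vertices of large degree
    ([dense_leave_orientation]). *)

Set Implicit Arguments.
Unset Strict Implicit.
Unset Printing Implicit Defensive.

Import Order.TTheory GRing.Theory Num.Theory.
Local Open Scope nat_scope.

(** * Orientations with bounded out-degrees *)

Section Orientation.
Variable V : finType.
Implicit Types (D O : {set V * V}) (T : {set V}) (d : V -> nat).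

Definition arcs_within D T : nat := #|D :&: setX T T|.
Definition outdeg D (x : V) : nat := #|[set y | (x, y) \in D]|.
Definition asym D := forall x y, (x, y) \in D -> (y, x) \notin D.
(** Counting both directions makes O a set with one arc for each edge of D,
    hence again asymmetric when D is. *)
Definition same_edges D O := forall x y,
  ((x, y) \in O) + ((y, x) \in O) = ((x, y) \in D) + ((y, x) \in D).

(** Directing every edge of a k-star decomposition away from the centre of its
    star gives such an orientation, with c(x) the number of stars centred at x. *)
Definition star_orientable k D := exists (O : {set V * V}) (c : V -> nat),
  same_edges D O /\ forall x, outdeg O x = k * c x.

Lemma arcs_withinT D : arcs_within D setT = #|D|.
Proof.
rewrite /arcs_within (_ : setX _ _ = setT) ?setIT //.
by apply/setP=> -[x y]; rewrite !inE.
Qed.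

Lemma arcs_withinUI D T1 T2 :
  arcs_within D T1 + arcs_within D T2
  <= arcs_within D (T1 :|: T2) + arcs_within D (T1 :&: T2).
Proof.
rewrite /arcs_within -cardsUI leq_add //; apply: subset_leq_card; apply/subsetP.
  by move=> [x y]; rewrite !inE /=; case: (_ \in D) => //= /orP[]/andP[-> ->]; rewrite ?orbT.
by move=> [x y]; rewrite !inE /=; case: (_ \in D) => //= /andP[/andP[-> ->] /andP[-> ->]].
Qed.

Lemma arcs_withinD1 D x y T : (x, y) \in D ->
  arcs_within D T = arcs_within (D :\ (x, y)) T + ((x \in T) && (y \in T)).
Proof.
move=> Dxy; rewrite /arcs_within (cardsD1 (x, y)) !inE Dxy /= addnC.
by congr (_ + _); rewrite setIDAC.
Qed.

(** The edges inside T are directed away from vertices of T, so the condition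
    is necessary. It is sufficient by induction on the edges: an edge xy cannot
    be directed away from x only if some tight set contains x and not y, and
    two tight sets obstructing the two directions of xy are incompatible. *)
Lemma orientation D d : asym D ->
    (forall T, arcs_within D T <= \sum_(x in T) d x) ->
  exists2 O, same_edges D O & forall x, outdeg O x <= d x.
Proof.
elim/ltn_ind: {D}#|D| {-2}D d (erefl #|D|) => N IH D d cardD asymD Hd.
have [D0|[[x y] Dxy]] := set_0Vmem D.
  exists set0; first by move=> x y; rewrite D0.
  by move=> x; rewrite /outdeg (_ : [set y | _] = set0) ?cards0 //; apply/setP => y; rewrite !inE.
have neq_xy : x != y.
  by apply/eqP => exy; have := asymD _ _ Dxy; rewrite -exy in Dxy *; rewrite Dxy.
have Dyx := asymD _ _ Dxy.
set D' := D :\ (x, y).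
have cardD' : #|D'| < N by rewrite -cardD (cardsD1 (x, y) D) Dxy.
have asymD' : asym D'.
  by move=> u v; rewrite !inE => /andP[_ /asymD Dvu]; rewrite (negPf Dvu) andbF.
pose slack u v := [forall T : {set V},
  (u \in T) ==> (v \notin T) ==> (arcs_within D' T < \sum_(z in T) d z)].
(* With slack, directing the edge from u to v and lowering d at u keeps the
   condition on every T: only sets that contain u but not v lose anything. *)
have step u v : (u, v) = (x, y) \/ (u, v) = (y, x) -> slack u v ->
  exists2 O, same_edges D O & forall z, outdeg O z <= d z.
  move=> uv /forallP slack_uv.
  have neq_uv : u != v by case: uv => -[-> ->] //; rewrite eq_sym.
  have du : 0 < d u.
    have := slack_uv [set u]; rewrite !inE eqxx eq_sym neq_uv /= big_set1.
    exact: leq_ltn_trans.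
  have [|O EO dO] := IH _ cardD' D' (fun z => d z - (z == u)) erefl asymD'.
    move=> T; have := Hd T; rewrite (arcs_withinD1 T Dxy) -/D' => HT.
    have sum_le : \sum_(z in T) d z = \sum_(z in T) (d z - (z == u)) + (u \in T).
      case uT: (u \in T); last first.
        rewrite addn0; apply: eq_bigr => z zT; case: eqP => [zu|_]; last by rewrite subn0.
        by rewrite -zu zT in uT.
      rewrite (bigD1 u) //= [in RHS](bigD1 u) //= eqxx.
      rewrite [in RHS](eq_bigr d) => [|z /andP[_ /negPf->]]; last by rewrite subn0.
      by lia.
    have uvT : (x \in T) && (y \in T) = (u \in T) && (v \in T).
      by case: uv => -[-> ->] //; rewrite andbC.
    rewrite sum_le uvT in HT; have := slack_uv T; rewrite sum_le.
    by case: (u \in T) HT; case: (v \in T) => /=; lia.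
  exists ((u, v) |: O).
    have O'F a b : (a, b) = (x, y) \/ (a, b) = (y, x) -> ((a, b) \in O) = false.
      move=> H; have := EO a b; rewrite !inE.
      by case: H => -[-> ->]; rewrite (negPf Dyx) !andbF eqxx /=; case: (_ \in O).
    have cmp a b : (a, b) = (x, y) \/ (a, b) = (y, x) ->
       ((a, b) \in (u, v) |: O) + ((b, a) \in (u, v) |: O) = 1.
      move=> ab; have ba : (b, a) = (x, y) \/ (b, a) = (y, x) by case: ab => -[-> ->]; [right|left].
      rewrite !inE (O'F _ _ ab) (O'F _ _ ba) !orbF.
      have neq_yx : y != x by rewrite eq_sym.
      by case: ab => -[-> ->]; case: uv => -[-> ->];
         rewrite !xpair_eqE !eqxx ?(negPf neq_xy) ?(negPf neq_yx).
    move=> a b.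
    have [ab|abx] := eqVneq (a, b) (x, y).
      by rewrite (cmp a b (or_introl ab)); case: ab => -> ->; rewrite Dxy (negPf Dyx).
    have [ab|aby] := eqVneq (a, b) (y, x).
      by rewrite (cmp a b (or_intror ab)); case: ab => -> ->; rewrite Dxy (negPf Dyx).
    have bax : (b, a) != (x, y) by move: aby; rewrite !xpair_eqE andbC.
    have bay : (b, a) != (y, x) by move: abx; rewrite !xpair_eqE andbC.
    have := EO a b; rewrite !inE abx bax /= => <-.
    by case: uv => -[-> ->]; rewrite ?(negPf abx) ?(negPf aby) ?(negPf bax) ?(negPf bay).
  move=> z; rewrite /outdeg.
  have [->|zu] := eqVneq z u.
    have -> : [set w | (u, w) \in (u, v) |: O] = v |: [set w | (u, w) \in O].
      by apply/setP=> w; rewrite !inE xpair_eqE eqxx.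
    have := dO u; rewrite /outdeg eqxx /= cardsU1 => dOu; lia.
  have -> : [set w | (z, w) \in (u, v) |: O] = [set w | (z, w) \in O].
    by apply/setP=> w; rewrite !inE xpair_eqE (negPf zu).
  by have := dO z; rewrite /outdeg (negPf zu) subn0.
have [|/forallPn[T1]] := boolP (slack x y).
  by apply: step; left.
have [|/forallPn[T2]] := boolP (slack y x).
  by move=> H _; apply: (step y x) => //; right.
(* Tight sets on both sides contradict submodularity, as their union spans
   the edge xy in addition. *)
rewrite !negb_imply -!leqNgt => /and3P[yT2 xT2 tight2] /and3P[xT1 yT1 tight1].
have := arcs_withinUI D' T1 T2.
have := Hd (T1 :|: T2); have := Hd (T1 :&: T2); rewrite !(arcs_withinD1 _ Dxy) -/D'.
rewrite !inE xT1 yT2 orbT (negPf xT2) /= => HI HU sub.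
have sumUI : \sum_(z in T1 :|: T2) d z + \sum_(z in T1 :&: T2) d z
    = \sum_(z in T1) d z + \sum_(z in T2) d z.
  rewrite ![\sum_(z in _) _]big_mkcond -!big_split /=; apply: eq_bigr => z _.
  by rewrite in_setU in_setI; case: (z \in T1); case: (z \in T2); rewrite ?addn0.
lia.
Qed.
End Orientation.

(** * Graphs with many dominating vertices *)

Section Join.
Variable V : finType.
Implicit Types (D O : {set V * V}) (T X U : {set V}) (c d : V -> nat).

(** A dominating vertex of the underlying graph. *)
Definition full_vertex D w := forall v, ((w, v) \in D) + ((v, w) \in D) = (v != w).

Lemma arcs_withinE D T :
  arcs_within D T = \sum_(x in T) \sum_(y in T) ((x, y) \in D).
Proof.
rewrite /arcs_within -sum1_card pair_big /= [LHS]big_mkcond [RHS]big_mkcond /=.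
apply: eq_bigr => -[x y] _; rewrite !inE /=.
by case: (_ \in D); case: (_ \in T) => //=; case: (_ \in T).
Qed.

Lemma double_bin2 j : 2 * 'C(j, 2) + j = j * j.
Proof.
elim: j => // j IHj; rewrite binS bin1; nia.
Qed.

Lemma arcs_withinU1 D w T : full_vertex D w -> w \notin T ->
  arcs_within D (w |: T) = arcs_within D T + #|T|.
Proof.
move=> full_w wT; rewrite !arcs_withinE big_setU1 //= big_setU1 //=.
have -> : (w, w) \in D = false by have := full_w w; rewrite eqxx; case: (_ \in D).
rewrite [X in _ + X](eq_bigr (fun x => ((x, w) \in D) + \sum_(y in T) ((x, y) \in D))).
  2: by move=> x xT; rewrite big_setU1.
rewrite big_split /= add0n addnA -big_split /= addnC; congr (_ + _).
rewrite -sum1_card; apply: eq_bigr => y yT; rewrite full_w.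
by case: eqP yT wT => // -> ->.
Qed.

Lemma arcs_within_join D X T : [disjoint X & T] ->
    {in T, forall w, full_vertex D w} ->
  arcs_within D (X :|: T) = arcs_within D X + #|X| * #|T| + 'C(#|T|, 2).
Proof.
elim/ltn_ind: {T}#|T| {-2}T (erefl #|T|) => N IH T cardT disXT fullT.
have [->|[w wT]] := set_0Vmem T; first by rewrite setU0 cards0 muln0 !addn0.
have sDT : T :\ w \subset T by apply: subD1set.
have cT : #|T| = #|T :\ w|.+1 by rewrite (cardsD1 w) wT.
have -> : X :|: T = w |: (X :|: (T :\ w)) by rewrite setUCA setD1K.
rewrite arcs_withinU1; last first.
- by rewrite !inE eqxx orbF; apply: contraL wT => wX; rewrite (disjointFr disXT wX).
- exact: fullT.
rewrite (IH _ _ _ erefl); first last.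
- by move=> v vT; apply: fullT; apply: (subsetP sDT).
- by rewrite disjoint_sym (disjointWl sDT) // disjoint_sym.
- lia.
rewrite cardsU (_ : X :&: (T :\ w) = set0) ?cards0; last first.
  by apply: disjoint_setI0; rewrite disjoint_sym (disjointWl sDT) // disjoint_sym.
rewrite cT binS bin1; nia.
Qed.

Lemma card_join D U : {in ~: U, forall w, full_vertex D w} ->
  #|D| = arcs_within D U + #|U| * #|~: U| + 'C(#|~: U|, 2).
Proof.
move=> fullD; rewrite -arcs_within_join //; last by rewrite -setI_eq0 setICr.
by rewrite setUCr arcs_withinT.
Qed.

Lemma full_tournament D T : (forall v, full_vertex D v) ->
  arcs_within D T = 'C(#|T|, 2).
Proof.
move=> full; have /= := @arcs_within_join D set0 T; rewrite set0U cards0 => ->.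
- by rewrite /arcs_within (_ : setX _ _ = set0) ?setI0 ?cards0 //; apply/setP=> -[x y]; rewrite !inE.
- by rewrite -setI_eq0 set0I.
- by move=> v _.
Qed.

Lemma card_arcs D : #|D| = \sum_x \sum_y ((x, y) \in D).
Proof.
rewrite pair_bigA /= -sum1_card [LHS]big_mkcond /=.
by apply: eq_bigr => -[x y] _; case: (_ \in _).
Qed.

Lemma outdegE D x : outdeg D x = \sum_y ((x, y) \in D).
Proof.
by rewrite /outdeg -sum1_card big_mkcond; apply: eq_bigr => y _; rewrite inE; case: (_ \in _).
Qed.

Lemma sum_outdeg D : \sum_x outdeg D x = #|D|.
Proof. by rewrite card_arcs; apply: eq_bigr => x _; rewrite outdegE. Qed.

Lemma same_edges_card D O : same_edges D O -> #|O| = #|D|.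
Proof.
have cardE (R : {set V * V}) : \sum_x \sum_y (((x, y) \in R) + ((y, x) \in R)) = 2 * #|R|.
  rewrite (eq_bigr (fun x => \sum_y ((x, y) \in R) + \sum_y ((y, x) \in R))); last first.
    by move=> x _; rewrite big_split.
  by rewrite big_split /= [X in _ + X]exchange_big /= addnn -mul2n card_arcs.
move=> EO; apply/eqP; rewrite -(eqn_pmul2l (isT : 0 < 2)) -!cardE; apply/eqP.
by apply: eq_bigr => x _; apply: eq_bigr => y _.
Qed.

Lemma orientation_exact D d : asym D ->
    (forall T, arcs_within D T <= \sum_(x in T) d x) -> \sum_x d x = #|D| ->
  exists2 O, same_edges D O & forall x, outdeg O x = d x.
Proof.
move=> asymD Hd sumd; have [O EO dO] := orientation asymD Hd.
exists O => // x; apply/eqP; rewrite eqn_leq dO /= leqNgt; apply/negP => lt_x.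
have : \sum_x outdeg O x < \sum_x d x.
  rewrite (bigD1 x) //= [X in _ < X](bigD1 x) //= -addSn leq_add //.
  by apply: leq_sum => y _.
by rewrite sum_outdeg sumd (same_edges_card EO) ltnn.
Qed.

(** A quadratic with leading coefficient 1 is convex, so an upper bound at the
    ends of an interval is an upper bound inside. *)
Lemma convex_between (A B l j h : int) : (l <= j -> j <= h ->
  l * l + B * l <= A -> h * h + B * h <= A -> j * j + B * j <= A)%R.
Proof.
move=> lj jh Hl Hh; have : (0 <= (j - l) * (h - j))%R by rewrite mulr_ge0 ?subr_ge0.
have [Bge|Blt] := leP 0%R (l + h + B)%R.
  have : (0 <= (h - j) * (l + h + B))%R by rewrite mulr_ge0 ?subr_ge0.
  by lia.
have : (0 <= (j - l) * - (l + h + B))%R by rewrite mulr_ge0 ?subr_ge0 // oppr_ge0 ltW.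
by lia.
Qed.

(** The numerical part of [join_orientation], for a set with x old vertices and
    j new ones. The number of edges that it spans is quadratic and convex in j,
    while the least number of stars centred at j new vertices is linear for
    j <= p and for j >= p. By convexity the three values j = 0, p, s suffice;
    the hypotheses are the inequality at these three values, the last one
    after subtraction of the total. *)
Lemma join_arith (s p n eU KU k K e x a j q : nat) : p <= s -> j <= s -> j - p <= q ->
    eU + n * s + 'C(s, 2) = k * (KU + a * s + (s - p)) ->
    e <= k * K -> e + s * x + k * KU <= eU + s * n + k * K ->
    e + p * x + 'C(p, 2) <= k * K + k * a * p ->
  e + x * j + 'C(j, 2) <= k * (K + (a * j + q)).
Proof.
move=> le_ps le_js le_q tot low high mid.
have := double_bin2 j; have := double_bin2 p; have := double_bin2 s.
move: 'C(j, 2) 'C(p, 2) 'C(s, 2) tot mid => Cj Cp Cs tot mid dCs dCp dCj.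
have [le_jp|lt_pj] := leqP j p.
  suff : (j%:Z * j%:Z + (2 * x%:Z - 1 - 2 * k%:Z * a%:Z) * j%:Z
          <= 2 * (k * K)%:Z - 2 * e%:Z)%R by clear tot high; nia.
  by apply: (@convex_between _ _ 0%R _ p%:Z); lia.
suff : (j%:Z * j%:Z + (2 * x%:Z - 1 - 2 * k%:Z * a%:Z - 2 * k%:Z) * j%:Z
        <= 2 * (k * K)%:Z - 2 * e%:Z - 2 * k%:Z * p%:Z)%R.
  by have := leq_mul (leqnn k) le_q; lia.
have [t def_s] : exists t, s = p + t by exists (s - p); lia.
rewrite {}def_s addKn in le_ps le_js tot high dCs *.
by apply: (@convex_between _ _ p%:Z _ (p + t)%:Z); lia.
Qed.

Lemma subset_of_size X i : i <= #|X| -> exists2 P : {set V}, P \subset X & #|P| = i.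
Proof.
move=> le_i; exists [set x in take i (enum X)].
  by apply/subsetP=> x; rewrite inE => /mem_take; rewrite mem_enum.
by rewrite cardsE (card_uniqP (take_uniq _ (enum_uniq _))) size_takel // -cardE.
Qed.

(** The vertices outside U dominate, so they play the same role, and the values
    of c on them may as well differ by at most one: a on p of them and a + 1
    on the others. Then the condition of [orientation_exact] for all vertex
    sets reduces to sets made of a subset X of U together with none, all, or
    exactly the p low ones of the vertices outside U. *)
Lemma join_orientation D U k c a p : asym D ->
    {in ~: U, forall w, full_vertex D w} -> p <= #|~: U| ->
    (forall X, X \subset U -> arcs_within D X <= k * \sum_(x in X) c x) ->
    (forall X, X \subset U ->
       arcs_within D X + #|~: U| * #|X| + k * \sum_(x in U) c x
       <= arcs_within D U + #|~: U| * #|U| + k * \sum_(x in X) c x) ->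
    (forall X, X \subset U ->
       arcs_within D X + p * #|X| + 'C(p, 2) <= k * \sum_(x in X) c x + k * a * p) ->
    #|D| = k * (\sum_(x in U) c x + a * #|~: U| + (#|~: U| - p)) ->
  star_orientable k D.
Proof.
set s := #|~: U| => asymD fullD le_ps low high mid tot.
have [P sPW cardP] := subset_of_size le_ps.
pose c' x := if x \in U then c x else if x \in P then a else a.+1.
have c'W (T : {set V}) : \sum_(x in T :\: U) c' x = a * #|T :\: U| + #|(T :\: U) :\: P|.
  rewrite (eq_bigr (fun x => a + (x \notin P))); last first.
    move=> x; rewrite inE /c' => /andP[/negPf-> _].
    by case: (_ \in P); rewrite ?addn0 ?addn1.
  rewrite big_split /= sum_nat_const mulnC; congr (_ + _).
  rewrite -sum1_card [LHS]big_mkcond [RHS]big_mkcond; apply: eq_bigr => x _.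
  by rewrite !inE; case: (x \in P); case: (x \in U); case: (x \in T).
have c'U (T : {set V}) : \sum_(x in T :&: U) c' x = \sum_(x in T :&: U) c x.
  by apply: eq_bigr => x; rewrite inE /c' => /andP[_ ->].
have [||O EO dO] := @orientation_exact D (fun x => k * c' x) asymD.
- move=> T; rewrite -big_distrr (big_setID U) /= c'U c'W.
  have -> : arcs_within D T = arcs_within D ((T :&: U) :|: (T :\: U)) by rewrite setID.
  have sXU : T :&: U \subset U by apply: subsetIr.
  have sWU : T :\: U \subset ~: U by rewrite setDE subsetIr.
  rewrite arcs_within_join; last first.
  + by move=> w /(subsetP sWU); apply: fullD.
  + rewrite -setI_eq0; apply/eqP/setP=> x; rewrite !inE.
    by case: (x \in U); rewrite ?andbF.
  have := low _ sXU; have := high _ sXU; have := mid _ sXU.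
  have : #|(T :\: U)| - p <= #|(T :\: U) :\: P|.
    by rewrite -cardP [X in _ <= X]cardsD leq_sub2l // subset_leq_card // subsetIr.
  have := card_join fullD; rewrite -/s.
  have : #|T :\: U| <= s by apply: subset_leq_card.
  move=> js dW le_q mid' high' low'.
  by apply: (join_arith le_ps js le_q _ low' high' mid'); rewrite -dW tot.
- rewrite tot -big_distrr /=; congr (k * _).
  rewrite (bigID (mem U)) /= -addnA; congr (_ + _).
    by apply: eq_bigr => x; rewrite /c' => ->.
  have := c'W setT; rewrite setTD; under eq_bigl do rewrite inE; move=> ->.
  by rewrite -cardP cardsD (setIidPr sPW).
by exists O, c'.
Qed.
End Join.

(** * A greedy choice of the centres *)

Section Greedy.
Variable V : finType.
Implicit Types (D O : {set V * V}) (T X U : {set V}) (c d : V -> nat).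

Definition outdeg_in D U x := \sum_(y in U) ((x, y) \in D).

Lemma sum_setD (F : V -> nat) U X : X \subset U ->
  \sum_(x in U) F x = \sum_(x in X) F x + \sum_(x in U :\: X) F x.
Proof. by move=> sXU; rewrite (big_setID X) /= (setIidPr sXU). Qed.

(** This is how an arbitrary orientation of the graph on U yields the first two
    conditions of [join_orientation] as soon as k * c(x) lies between the
    out-degree of x in U and that out-degree plus the number of new vertices. *)
Lemma arcs_within_le_outdeg D U X : X \subset U ->
  arcs_within D X <= \sum_(x in X) outdeg_in D U x.
Proof.
move=> sXU; rewrite arcs_withinE; apply: leq_sum => x _.
by rewrite /outdeg_in (sum_setD _ sXU) leq_addr.
Qed.

(** One step of the descent in [greedy_orientation], at a vertex with out-degree
    o inside U and m stars: if it fails the upper stability condition, then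
    removing one star leaves the lower condition true. *)
Lemma descend_arith s k p o m : p <= s -> k <= s ->
  (o + s - k * m) * s < (s - p) * (s - k) -> k * m <= o + s ->
  0 < m /\ p * (s - k) + s * o <= s * (k * m.-1).
Proof.
move=> ps ks unst mle.
have [t st] : exists t, s = k + t by exists (s - k); lia.
have [v sv] : exists v, s = p + v by exists (s - p); lia.
have [w ow] : exists w, o + s = k * m + w by exists (o + s - k * m); lia.
have Ew : o + s - k * m = w by lia.
have Ev : s - p = v by lia.
have Et : s - k = t by lia.
rewrite Ew Ev Et in unst *; clear Ew.
case: m mle ow => [|m] mle ow.
  by exfalso; rewrite muln0 in ow; nia.
split=> //=.
have : s * (o + s) = s * (k * m.+1 + w) by rewrite ow.
have : s * t = p * t + v * t by rewrite -mulnDl -sv.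
nia.
Qed.

(** The hypothesis [gap] is what remains of the wanted inequality, multiplied by
    s * s, once the summed estimate and the total number of edges have been
    substituted; hence the list of products below. *)
Lemma greedy_arith s k p n a x (e eU E EU K KU : nat) : 0 < s -> p <= s -> k <= s ->
    2 * k * s <= s * s + 2 * n * (s - k) ->
    eU + s * n + 'C(s, 2) = k * (KU + a * s + (s - p)) ->
    e <= E -> eU = EU ->
    s * s * p * x + s * s * E + n * ((s - p) * (s - k) * p) + s * p * (k * KU)
    <= s * s * (k * K) + s * p * EU + s * s * p * n ->
  e + p * x + 'C(p, 2) <= k * K + k * a * p.
Proof.
move=> s0 ps ks gap tot eE ? sum; subst eU.
have := double_bin2 p; have := double_bin2 s.
move: 'C(p, 2) 'C(s, 2) tot => Cp Cs tot dCs dCp.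
rewrite -(leq_pmul2l (_ : 0 < s * s)); last by rewrite muln_gt0 s0.
have [t st] : exists t, s = k + t by exists (s - k); lia.
have [v sv] : exists v, s = p + v by exists (s - p); lia.
have Ev : s - p = v by lia.
have Et : s - k = t by lia.
rewrite Ev Et in gap tot sum.
have H1 := leq_mul (leqnn (p * v)) gap.
have H2 : s * p * (EU + s * n + Cs) = s * p * (k * (KU + a * s + v)) by rewrite tot.
have H3 := leq_mul (leqnn (s * s)) eE.
have H4 : s * p * (2 * Cs + s) = s * p * (s * s) by rewrite dCs.
have H5 : s * s * (2 * Cp + p) = s * s * (p * p) by rewrite dCp.
have H7 : s * s * p * s = s * s * p * p + s * s * p * v by rewrite -mulnDr -sv.
have H8 : s * p * v * s = s * p * v * p + s * p * v * v by rewrite -mulnDr -sv.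
clear -H1 H2 H3 H4 H5 H7 H8 sum.
lia.
Qed.

(** Let s be the number of vertices outside U. Fix any orientation inside U,
    with out-degrees o(x), so that r(x) = k * c(x) - o(x) edges from x to the
    outside must be directed away from x, and 0 <= r(x) <= s. The last condition of
    [join_orientation] follows from
      sum over U of min (r(x) / p) ((s - r(x)) / (s - p)) >= k - s / 2,
    and the hypothesis relating s, k and U says that this holds when each term
    is at least (s - k) / s. The largest c with r <= s has r > s - k, which
    makes the first entries of the minima large enough. As long as the second
    entry is too small at some x, remove one star from x: one more star then
    goes to the outside, p decreases by one, and the bound on the first
    entries persists. When p reaches 0 the condition is trivial. *)
Lemma greedy_orientation D U k : 0 < k -> k <= #|~: U| ->
    2 * k * #|~: U| <= #|~: U| * #|~: U| + 2 * #|U| * (#|~: U| - k) ->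
    asym D -> {in ~: U, forall w, full_vertex D w} -> k %| #|D| ->
  star_orientable k D.
Proof.
set s := #|~: U| => k0 ks gap asymD fullD /dvdnP[M]; rewrite mulnC => DM.
pose o := outdeg_in D U.
have s0 : 0 < s by apply: leq_trans ks.
have sum_o : \sum_(x in U) o x = arcs_within D U by rewrite arcs_withinE.
have cardD := card_join fullD; rewrite -/s in cardD.
(* The value a is constant along the descent: each star taken away from U turns
   one outside vertex with a stars into one with a + 1. *)
have descend p c a : p <= s ->
    {in U, forall x, k * c x <= o x + s} ->
    {in U, forall x, p * (s - k) + s * o x <= s * (k * c x)} ->
    #|D| = k * (\sum_(x in U) c x + a * s + (s - p)) ->
  exists c' p', [/\ p' <= s, {in U, forall x, k * c' x <= o x + s},
    {in U, forall x, p' * (s - k) + s * o x <= s * (k * c' x)},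
    p' = 0 \/ {in U, forall x, (s - p') * (s - k) <= (o x + s - k * c' x) * s} &
    #|D| = k * (\sum_(x in U) c' x + a * s + (s - p'))].
  elim: p c => [|p IHp] c ps cle cge tot; first by exists c, 0; split=> //; left.
  have [/forall_inP|/forall_inPn[x xU]] :=
      boolP [forall x in U, (s - p.+1) * (s - k) <= (o x + s - k * c x) * s].
    by move=> stable; exists c, p.+1; split=> //; right.
  rewrite -ltnNge => /(descend_arith ps ks)/(_ (cle x xU))[cx0 cx1].
  apply: (IHp (fun y => c y - (y == x)) (ltnW ps)).
  - move=> y yU; apply: leq_trans (cle y yU).
    by rewrite leq_mul2l leq_subr orbT.
  - move=> y yU; have [->|_] := eqVneq y x; first by rewrite subn1; nia.
    by rewrite subn0; have := cge y yU; nia.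
  - rewrite tot; have -> : \sum_(y in U) c y = (\sum_(y in U) (c y - (y == x))).+1.
      rewrite (bigD1 x) //= [in RHS](bigD1 x) //= eqxx.
      rewrite [in RHS](eq_bigr c) => [|z /andP[_ /negPf->]]; last by rewrite subn0.
      by lia.
    by congr (k * _); move: ps; lia.
pose c0 x := (o x + s) %/ k.
have c0le x : k * c0 x <= o x + s by rewrite mulnC leq_trunc_div.
have c0gt x : o x + s < k * c0 x + k.
  by rewrite {1}(divn_eq (o x + s) k) mulnC ltn_add2l ltn_pmod.
have sum_c0 : \sum_(x in U) c0 x <= M.
  rewrite -(leq_pmul2l k0) -DM cardD big_distrr /=.
  apply: leq_trans (leq_addr _ _); rewrite -sum_o -sum_nat_const -big_split /=.
  by apply: leq_sum => x _.
(* N stars remain for the outside. The initial p is s - N %% s, so that p = s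
   when s divides N. *)
pose N := M - \sum_(x in U) c0 x.
have modN : N %% s < s by rewrite ltn_pmod.
have [||||c [p [ps cle cge stable tot]]] := descend (s - N %% s) c0 (N %/ s).
- by rewrite leq_subr.
- by move=> x _.
- move=> x _; have := c0gt x; have : s - N %% s <= s by rewrite leq_subr.
  by move: (s - N %% s) (c0 x) (o x) => p m y; nia.
- rewrite DM; congr (k * _); have := divn_eq N s; rewrite /N.
  by move: modN; rewrite -/N; lia.
have cge0 x : x \in U -> o x <= k * c x.
  by move=> xU; rewrite -(leq_pmul2l s0); apply: leq_trans (leq_addl _ _) (cge x xU).
apply: (@join_orientation _ D U k c (N %/ s) p) => //.
- move=> X sXU; apply: leq_trans (arcs_within_le_outdeg D sXU) _.
  rewrite big_distrr /=; apply: leq_sum => x /(subsetP sXU) xU.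
  exact: cge0.
- move=> X sXU; have := arcs_within_le_outdeg D sXU.
  rewrite -sum_o -/s -/o (sum_setD o sXU) (sum_setD c sXU).
  have : \sum_(x in U :\: X) k * c x <= \sum_(x in U :\: X) (o x + s).
    by apply: leq_sum => x; rewrite inE => /andP[_ /cle].
  rewrite big_split -big_distrr sum_nat_const /=.
  have : #|U| = #|X| + #|U :\: X| by rewrite -(cardsID X U) (setIidPr sXU).
  by move=> ->; lia.
- move=> X sXU.
  have sXo := arcs_within_le_outdeg D sXU; rewrite -/o in sXo.
  case: stable => [p0|stable].
    rewrite p0 mul0n addn0 bin0n addn0 muln0 addn0; apply: leq_trans sXo _.
    rewrite big_distrr /=; apply: leq_sum => x /(subsetP sXU) xU.
    exact: cge0.
  apply: (@greedy_arith s k p #|U| (N %/ s) #|X| _ _ _ _ _ (\sum_(x in U) c x)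
     s0 ps ks gap _ sXo (esym sum_o)).
    by rewrite -tot cardD; lia.
  pose Q := (s - p) * (s - k) * p.
  have inX : \sum_(x in X) (s * s * p + s * s * o x + Q + s * p * (k * c x))
      <= \sum_(x in X) (s * s * (k * c x) + s * p * o x + s * s * p).
    apply: leq_sum => x /(subsetP sXU) xU.
    have := leq_mul (leqnn (s - p)) (cge x xU).
    have sE : s * s = s * (s - p) + s * p by rewrite -mulnDr subnK.
    by rewrite /Q !sE; move: (s - p) (k * c x); lia.
  have outX : \sum_(x in U :\: X) (Q + s * p * (k * c x))
      <= \sum_(x in U :\: X) (s * p * o x + s * s * p).
    apply: leq_sum => x; rewrite inE => /andP[_ xU].
    have [w ow] : exists w, o x + s = k * c x + w.
      by exists (o x + s - k * c x); have := cle x xU; lia.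
    have := leq_mul (leqnn p) (stable x xU); rewrite ow addKn.
    have : s * p * (o x + s) = s * p * (k * c x + w) by rewrite ow.
    by rewrite /Q; move: (k * c x) (s - p) (s - k); lia.
  have := leq_add inX outX.
  have cardU : #|U| = #|X| + #|U :\: X| by rewrite -(cardsID X U) (setIidPr sXU).
  rewrite (sum_setD o sXU) (sum_setD c sXU) cardU -/Q.
  have distr T b (F : V -> nat) : \sum_(x in T) b * F x = b * \sum_(x in T) F x.
    by rewrite big_distrr.
  rewrite !big_split /= !sum_nat_const !distr.
  lia.
Qed.
End Greedy.

(** * Graphs on 3k vertices *)

Section Tight.
Variable V : finType.
Implicit Types (D O : {set V * V}) (T X Y Z U : {set V}) (c d : V -> nat).

Definition degree_in D U x := \sum_(y in U) (((x, y) \in D) + ((y, x) \in D)).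

Lemma arcs_withinS D X Y : X \subset Y -> arcs_within D X <= arcs_within D Y.
Proof. by move=> sXY; apply: subset_leq_card; rewrite setIS // setXS. Qed.

(** In the sum of the degrees of Z, the edges inside Z are counted twice and the
    edges between Z and the rest of U once. *)
Lemma arcs_within_cut D U Z : Z \subset U ->
  arcs_within D U + arcs_within D Z =
  arcs_within D (U :\: Z) + \sum_(z in Z) degree_in D U z.
Proof.
move=> sZU; pose f (A B : {set V}) := \sum_(x in A) \sum_(y in B) ((x, y) \in D).
have fE A : arcs_within D A = f A A by rewrite arcs_withinE.
have fl A : f U A = f Z A + f (U :\: Z) A by rewrite /f (sum_setD _ sZU).
have fr A : f A U = f A Z + f A (U :\: Z).
  by rewrite /f -big_split; apply: eq_bigr => x _; rewrite (sum_setD _ sZU).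
have -> : \sum_(z in Z) degree_in D U z = f Z U + f U Z.
  rewrite /f [X in _ + X]exchange_big -big_split /=; apply: eq_bigr => x _.
  by rewrite /degree_in big_split.
by rewrite !fE (fl U) (fl Z) !fr; lia.
Qed.

Lemma sum_degree D U : \sum_(x in U) degree_in D U x = 2 * arcs_within D U.
Proof.
have := arcs_within_cut D (subxx U); rewrite setDv.
have -> : arcs_within D set0 = 0.
  by rewrite arcs_withinE big_set0.
by rewrite add0n addnn -mul2n.
Qed.

Lemma asym_arcs_within D T : asym D -> arcs_within D T <= 'C(#|T|, 2).
Proof.
move=> asymD; have := sum_degree D T; have := double_bin2 #|T|.
suff : \sum_(x in T) degree_in D T x + #|T| <= #|T| * #|T| by lia.
rewrite -[X in _ + X]sum1_card -big_split -sum_nat_const /=.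
apply: leq_sum => x xT; rewrite (cardsD1 x T) xT addnC leq_add2l.
have Dxx : (x, x) \in D = false.
  by apply/negP=> H; have := asymD _ _ H; rewrite H.
rewrite /degree_in (big_setD1 x) //= Dxx -sum1_card; apply: leq_sum => y _.
by case xy: (_ \in D); [rewrite (negPf (asymD _ _ xy))|case: (_ \in D)].
Qed.

Lemma bin2_le k x : x <= 2 * k + 1 -> 'C(x, 2) <= k * x.
Proof.
move=> le_x; have := leq_mul le_x (leqnn x); have := double_bin2 x; lia.
Qed.

(** Sets with x + p <= 2k + 1 vertices cannot span more than k(x + p) edges. For
    larger ones the bound e <= eU on the old part is used, the worst case being
    x = 2k + 2 - p if p <= k and x = n otherwise. *)
Lemma sparse_leave_arith (s k n p x e eU : nat) : n + s = 3 * k -> p <= s -> x <= n ->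
    k <= s -> s < 3 * k ->
    eU + n * s + 'C(s, 2) = k * (n + 1 * s + (s - p)) ->
    e <= 'C(x, 2) -> e <= eU ->
  e + p * x + 'C(p, 2) <= k * x + k * 1 * p.
Proof.
move=> ns ps xn ks s3 tot ex eU_ge.
have := double_bin2 x; have := double_bin2 p; have := double_bin2 s.
move: 'C(x, 2) 'C(p, 2) 'C(s, 2) tot ex => Cx Cp Cs tot ex dCs dCp dCx.
have [le_xp|gt_xp] := leqP (x + p) (2 * k + 1).
  have := leq_mul le_xp (leqnn (x + p)); lia.
have [v sv] : exists v, s = p + v by exists (s - p); lia.
have Ev : s - p = v by lia.
have [t st] : exists t, s = k + t by exists (s - k); lia.
have nt : n + t = 2 * k by lia.
have n0 : 0 < n by lia.
have nk := congr1 (muln k) nt; have ntt := congr1 (muln t) nt.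
have tn : t * 1 <= t * n by rewrite leq_mul2l n0 orbT.
rewrite Ev in tot; clear ns ks s3 Ev.
have [le_pk|lt_kp] := leqP p k.
  have [y ky] : exists y, k = p + y by exists (k - p); lia.
  have [z xz] : exists z, x = k + y + 2 + z by exists (x - (k + y + 2)); lia.
  clear le_pk gt_xp ex dCx; have := leq0n (y * z); have vE : v = y + t by lia.
  clear sv; subst s x k v.
  lia.
have [r pr] : exists r, p = k + r by exists (p - k); lia.
have tE : t = r + v by lia.
have nr := congr1 (muln r) nt; have vn : v * 1 <= v * n by rewrite leq_mul2l n0 orbT.
have rx : r * x <= r * n by rewrite leq_mul2l xn orbT.
clear gt_xp nt; subst p t; lia.
Qed.

(** One star at each vertex and a second one at all but p of the vertices
    outside U. The vertices of one star only are no obstacle because a clique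
    on 2k + 1 of them can still be oriented and D has too few edges for larger
    dense sets. *)
Lemma sparse_leave_orientation D U k p : #|U| + #|~: U| = 3 * k ->
    p <= #|~: U| -> k <= #|~: U| -> #|~: U| < 3 * k ->
    asym D -> {in ~: U, forall w, full_vertex D w} ->
    #|D| = k * (#|U| + 1 * #|~: U| + (#|~: U| - p)) ->
  star_orientable k D.
Proof.
set s := #|~: U|; set n := #|U| => ns ps ks s3 asymD fullD tot.
have cardD := card_join fullD; rewrite -/s -/n in cardD.
apply: (@join_orientation _ D U k (fun=> 1) 1 p) => //; rewrite ?sum1_card //.
- move=> X sXU; rewrite sum1_card; apply: leq_trans (asym_arcs_within X asymD) _.
  have : #|X| <= n by apply: subset_leq_card.
  by move=> le_n; apply: bin2_le; move: ns ks le_n; lia.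
- move=> X sXU; rewrite sum1_card -/s -/n.
  have Xn : #|X| <= n by apply: subset_leq_card.
  have := arcs_withinS D sXU.
  have [v ->] : exists v, n = #|X| + v by exists (n - #|X|); lia.
  have : k * v <= s * v by rewrite leq_mul2r ks orbT.
  by lia.
- move=> X sXU; rewrite sum1_card.
  apply: (@sparse_leave_arith s k n p #|X| _ (arcs_within D U)) => //.
  + by apply: subset_leq_card.
  + by rewrite -cardD.
  + exact: asym_arcs_within.
  + exact: arcs_withinS.
Qed.

(** The graph on U misses only k * a < k * k / 4 pairs, too few for more than
    |U| - k / 4 > 5k / 4 vertices to miss at least |U| - k > k / 2 pairs each. *)
Lemma many_large_degrees D U k x a : asym D ->
    2 * arcs_within D U + 2 * k * a + #|U| = #|U| * #|U| ->
    4 * a < k -> 4 * x < k -> 3 * k < 2 * #|U| ->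
  x <= #|[set u in U | k <= degree_in D U u]|.
Proof.
move=> asymD eU a_le x_le n_ge; rewrite leqNgt; apply/negP.
set H := [set u in U | _] => Hx.
have sHU : H \subset U by apply/subsetP=> u; rewrite inE => /andP[].
have := sum_degree D U; rewrite (sum_setD _ sHU).
have : \sum_(u in H) degree_in D U u <= #|H| * #|U|.
  rewrite -sum_nat_const; apply: leq_sum => u _; rewrite /degree_in -sum1_card.
  apply: leq_sum => y _; case uy: (_ \in D); last by case: (_ \in D).
  by rewrite (negPf (asymD _ _ uy)).
have : \sum_(u in U :\: H) degree_in D U u + #|U :\: H| <= #|U :\: H| * k.
  rewrite -[X in _ + X]sum1_card -big_split -sum_nat_const; apply: leq_sum => u /=.
  by rewrite !inE negb_and => /andP[/orP[/negPf->//|]]; rewrite -ltnNge addn1.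
have cardU : #|U| = #|H| + #|U :\: H| by rewrite -(cardsID H U) (setIidPr sHU).
move: (\sum_(u in H) _) (\sum_(u in U :\: H) _) => S1 S2.
move: cardU eU n_ge Hx; move: #|H| #|U :\: H| #|U| (arcs_within D U) => h g n e nE eU n_ge Hx H2 H1 H3.
have [q nq] : exists q, n = k + q by exists (n - k); lia.
have : 5 * k * (k + 1) <= 4 * g * (2 * q) by apply: leq_mul; lia.
have : k * (4 * a) <= k * k by rewrite leq_mul2l ltnW ?orbT.
have : g * n = g * (k + q) by rewrite nq.
have : n * n = (h + g) * n by rewrite -nE.
lia.
Qed.

(** Too many stars remain for one star at each vertex of U and two at each
    vertex outside, and a third star outside does not fit: the degrees are
    below 3k. So the x surplus stars are centred at vertices of U. The number
    of edges leaves a + x < k / 4, where a is the number of stars already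
    used; hence most vertices of U still have degree at least k inside U, and x
    of them can carry a second star. *)
Lemma dense_leave_orientation D U k a M : 0 < k -> #|U| + #|~: U| = 3 * k ->
    5 * k <= 4 * #|~: U| ->
    asym D -> {in ~: U, forall w, full_vertex D w} ->
    arcs_within D U + k * a = 'C(#|U|, 2) ->
    #|D| = k * M -> #|U| + 2 * #|~: U| <= M ->
  star_orientable k D.
Proof.
set s := #|~: U|; set n := #|U| => k0 ns s_ge asymD fullD eU tot M_ge.
have cardD := card_join fullD; rewrite -/s -/n in cardD.
have def_M : 2 * M + 2 * a + 3 = 9 * k.
  apply/eqP; rewrite -(eqn_pmul2l k0); apply/eqP.
  have := double_bin2 n; have := double_bin2 s; have := congr1 (muln (3 * k)) ns.
  have := congr1 (muln n) ns; have := congr1 (muln s) ns.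
  by move: tot cardD eU; move: (#|D|) => d; lia.
have [x Mx] : exists x, M = n + x + 2 * s by exists (M - n - 2 * s); lia.
have xa : 4 * x + 4 * a + 6 <= k by lia.
have [|Z sZH cardZ] := @subset_of_size _ [set u in U | k <= degree_in D U u] x.
  apply: (@many_large_degrees D U k x a) => //; rewrite -/n; last by lia.
  - by have := double_bin2 n; rewrite -eU; lia.
  - by lia.
  - by lia.
have sZU : Z \subset U by apply/subsetP=> u /(subsetP sZH); rewrite inE => /andP[].
have sum_c T : \sum_(u in T) (1 + (u \in Z)) = #|T| + #|T :&: Z|.
  rewrite big_split /= sum1_card; congr (_ + _).
  rewrite -sum1_card [LHS]big_mkcond [RHS]big_mkcond; apply: eq_bigr => u _.
  by rewrite inE; case: (u \in T); case: (u \in Z).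
have sum_cU : \sum_(u in U) (1 + (u \in Z)) = n + x.
  by rewrite sum_c (setIidPr sZU) cardZ.
have high X : X \subset U -> arcs_within D X + s * #|X| + k * (n + x)
    <= arcs_within D U + s * n + k * (#|X| + #|X :&: Z|).
  move=> sXU; have sZ'U : Z :\: X \subset U by apply: subset_trans (subsetDl _ _) sZU.
  have := arcs_within_cut D sZ'U.
  have : arcs_within D X <= arcs_within D (U :\: (Z :\: X)).
    apply: arcs_withinS; apply/subsetP=> u uX; rewrite !inE uX /=.
    by apply: (subsetP sXU).
  have : #|Z :\: X| * k <= \sum_(z in Z :\: X) degree_in D U z.
    rewrite -sum_nat_const; apply: leq_sum => z; rewrite inE => /andP[_ /(subsetP sZH)].
    by rewrite inE => /andP[].
  have := asym_arcs_within (Z :\: X) asymD; have := double_bin2 #|Z :\: X|.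
  have : n = #|X| + #|U :\: X| by rewrite /n -(cardsID X U) (setIidPr sXU).
  have : x = #|X :&: Z| + #|Z :\: X| by rewrite -cardZ -(cardsID X Z) setIC.
  have : #|Z :\: X| <= #|U :\: X| by apply: subset_leq_card; apply: setSD.
  have [t st] : exists t, s = k + t by exists (s - k); lia.
  have xt : x <= 2 * t by lia.
  move: (#|Z :\: X|) (#|U :\: X|) (\sum_(z in _) _) => z g S zg xz ng dC.
  have : z * x <= g * (2 * t) by apply: leq_mul.
  have : z * z <= z * x by rewrite leq_mul2l xz leq_addl orbT.
  rewrite st ng xz; lia.
apply: (@join_orientation _ D U k (fun u => 1 + (u \in Z)) 2 s) => //.
- move=> X sXU; rewrite sum_c mulnDr; apply: leq_trans (asym_arcs_within X asymD) _.
  have : #|X| <= n by apply: subset_leq_card.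
  move=> le_n; apply: leq_trans (leq_addr _ _); apply: bin2_le; move: ns s_ge le_n; lia.
- by move=> X sXU; rewrite sum_cU sum_c; apply: high.
- move=> X sXU; have := high X sXU; rewrite sum_c.
  by move: tot cardD; rewrite Mx; lia.
- by rewrite sum_cU -/s subnn addn0 tot Mx.
Qed.
End Tight.

(** * Orienting the leave of a partial decomposition *)

Section Leave.
Variable V : finType.
Implicit Types (C D O : {set V * V}) (T X Y Z U : {set V}) (c d : V -> nat).

(** The edges of C and of D partition those of the complete graph. *)
Definition complementary C D := forall x y,
  ((x, y) \in C) + ((y, x) \in C) + (((x, y) \in D) + ((y, x) \in D)) = (x != y).

Lemma complementary_within C D T : complementary C D ->
  arcs_within C T + arcs_within D T = 'C(#|T|, 2).
Proof.
move=> CD; rewrite -(@full_tournament _ (C :|: D)).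
  rewrite !arcs_withinE -big_split; apply: eq_bigr => x _.
  rewrite -big_split; apply: eq_bigr => y _; rewrite inE.
  by have := CD x y; case: (_ \in C); case: (_ \in D) => //=; case: (x != y); lia.
move=> v y; rewrite !inE eq_sym -CD.
have := CD v y; rewrite eq_sym.
by case: (_ \in C); case: (_ \in C); case: (_ \in D); case: (_ \in D); case: (y != v).
Qed.

(** Here C consists of stars directed away from their centres. On at most 2k
    vertices a degree is less than 2k, so no vertex is the centre of two stars;
    and two vertices that are centres of no star are not joined by C. So all
    edges of C meet the set of centres, which bounds the number of stars in
    terms of itself. *)
Lemma few_stars_on_few_vertices C D U k a : complementary C D -> C \subset setX U U ->
    (forall x, outdeg C x = k * a x) -> 0 < k -> k < #|U| -> #|U| <= 2 * k ->
  \sum_x a x + 2 * k < 2 * #|U|.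
Proof.
set n := #|U| => CD sCU Ca k0 kn nk.
have C0 x y : x \notin U -> ((x, y) \in C) = false.
  by move=> xU; apply/negP=> /(subsetP sCU); rewrite inE (negPf xU).
have a0 x : x \notin U -> a x = 0.
  move=> xU; have := Ca x; rewrite /outdeg (_ : [set y | _] = set0) ?cards0; first by nia.
  by apply/setP=> y; rewrite !inE C0.
have a1 x : x \in U -> a x <= 1.
  move=> xU; have : outdeg C x <= #|U :\ x|.
    apply: subset_leq_card; apply/subsetP=> y; rewrite !inE => Cxy.
    have := subsetP sCU _ Cxy; rewrite inE /= => /andP[_ ->]; rewrite andbT.
    by have := CD x y; rewrite eq_sym Cxy; case: (_ == _).
  have := cardsD1 x U; rewrite xU Ca -/n; move: (#|_ :\ x|) => m; nia.
pose Z := [set x in U | a x == 0].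
have sZU : Z \subset U by apply/subsetP=> x; rewrite inE => /andP[].
have sum_a : \sum_x a x = #|U :\: Z|.
  rewrite -sum1_card [RHS]big_mkcond /=; apply: eq_bigr => x _.
  rewrite !inE; case xU: (x \in U); last by rewrite a0 ?xU ?andbF.
  by have := a1 x xU; case: (a x) => [|[]].
have : arcs_within C Z = 0.
  apply/eqP; rewrite -leqn0 arcs_withinE big1 // => x.
  rewrite inE => /andP[_ /eqP ax]; apply/eqP; rewrite -leqn0.
  apply: (@leq_trans (outdeg C x)); last by rewrite Ca ax muln0.
  by rewrite outdegE [X in _ <= X](bigID (mem Z)) leq_addr.
have : arcs_within C U = k * \sum_x a x.
  rewrite big_distrr -(eq_bigr _ (fun x _ => Ca x)) sum_outdeg /arcs_within.
  by rewrite (setIidPl sCU).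
have := complementary_within Z CD; have := complementary_within U CD.
have := arcs_withinS D sZU; have := double_bin2 #|U|; have := double_bin2 #|Z|.
have : n = #|Z| + #|U :\: Z| by rewrite /n -(cardsID Z U) (setIidPr sZU).
rewrite -sum_a -/n; move: (\sum_x a x) (#|Z|) => m z nE.
have [->|m0] := posnP m; first by lia.
move=> dz dn leZU eU eZ cU cZ; rewrite -(leq_pmul2l m0) nE.
have := congr1 (muln n) nE; have := congr1 (muln m) nE; have := congr1 (muln z) nE.
lia.
Qed.

(** On 4k or more vertices the greedy choice works. On 3k vertices with k odd,
    [few_stars_on_few_vertices] shows that D still has enough edges for one star
    at each vertex on average. *)
Lemma leave_orientation C D U k a : complementary C D -> C \subset setX U U ->
    (forall x, outdeg C x = k * a x) -> 1 < k -> k < #|U| ->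
    k %| 'C(#|V|, 2) -> k <= #|~: U| ->
    4 * k <= #|V| /\ #|~: U| * #|~: U| <= 8 * k * (#|~: U| - k) \/
    [/\ odd k, #|V| = 3 * k & 5 * k <= 4 * #|~: U|] ->
  star_orientable k D.
Proof.
move=> CD sCU Ca k1 kn kV ks.
have cardV : #|V| = #|U| + #|~: U| by rewrite cardsC.
have asymD : asym D.
  move=> x y Dxy; apply/negP=> Dyx; have := CD x y; rewrite Dxy Dyx.
  by case: (_ == _); lia.
have fullD : {in ~: U, forall w, full_vertex D w}.
  move=> w; rewrite inE => wU v; rewrite eq_sym -CD.
  have C0 x y : (x == w) || (y == w) -> ((x, y) \in C) = false.
    move=> xyw; apply/negP=> /(subsetP sCU); rewrite inE /=.
    by case/orP: xyw => /eqP->; rewrite (negPf wU) ?andbF.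
  by rewrite !C0 ?eqxx ?orbT.
have cardC : #|C| = k * \sum_x a x.
  by rewrite big_distrr -(eq_bigr _ (fun x _ => Ca x)) sum_outdeg.
have eT := complementary_within setT CD; rewrite !arcs_withinT cardsT cardC in eT.
have eU : arcs_within D U + k * \sum_x a x = 'C(#|U|, 2).
  by rewrite -(complementary_within U CD) -cardC /arcs_within (setIidPl sCU) addnC.
have kD : k %| #|D| by rewrite -(dvdn_addr _ (dvdn_mulr (\sum_x a x) (dvdnn k))) eT.
case=> [[le4 gap]|[oddk eq3 s_ge]].
  apply: (@greedy_orientation _ D U k) => //; first exact: ltnW.
  have [t st] : exists t, #|~: U| = k + t by exists (#|~: U| - k); lia.
  move: cardV gap; rewrite st addKn => cardV gap.
  have := leq_mul le4 (leqnn t); rewrite cardV; lia.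
have [M def_M] := dvdnP kD; rewrite mulnC in def_M.
have alpha := @few_stars_on_few_vertices C D U k a CD sCU Ca (ltnW k1) kn.
have M_ge : #|U| + #|~: U| <= M.
  have dM : k * (2 * M + 2 * \sum_x a x + 3) = k * (9 * k).
    by have := double_bin2 #|V|; rewrite -eT def_M eq3; lia.
  have {}dM : 2 * M + 2 * \sum_x a x + 3 = 9 * k.
    by apply/eqP; rewrite -(eqn_pmul2l (ltnW k1)); apply/eqP.
  have : 5 * k != 4 * #|~: U|.
    by apply/eqP=> /(congr1 odd); rewrite !oddM oddk.
  by move: alpha; lia.
have [le_M|gt_M] := leqP M (#|U| + 2 * #|~: U|).
  apply: (@sparse_leave_orientation _ D U k (2 * #|~: U| + #|U| - M)) => //; try by lia.
  by rewrite def_M; congr (k * _); lia.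
by apply: (@dense_leave_orientation _ D U k (\sum_x a x) M); rewrite ?(ltnW k1) //; lia.
Qed.

End Leave.

(** In the complete graph on 2k vertices, one star at each vertex but one: a set
    of t <= 2k vertices spans t(t - 1)/2 <= k(t - 1) edges. *)
Lemma complete_orientation (V : finType) (D : {set V * V}) k : 0 < k ->
    (forall w, full_vertex D w) -> #|V| = 2 * k ->
  star_orientable k D.
Proof.
move=> k0 fullD cardV.
have v0P : 0 < #|V| by rewrite cardV muln_gt0.
pose v0 := enum_val (Ordinal v0P).
have sum_d (T : {set V}) : \sum_(x in T) k * (x != v0) + k * (v0 \in T) = k * #|T|.
  rewrite -big_distrr -mulnDr /=; congr (k * _).
  rewrite (cardsD1 v0 T) addnC; congr (_ + _).
  rewrite -sum1_card [LHS]big_mkcond [RHS]big_mkcond; apply: eq_bigr => x _.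
  by rewrite !inE; case: (x == v0); case: (x \in T).
have [||| O EO dO] := @orientation_exact V D (fun x => k * (x != v0)).
- move=> x y Dxy; have := fullD x y; rewrite Dxy.
  by case: ((y, x) \in D) => //; case: (_ != _).
- move=> T; rewrite full_tournament //.
  have := sum_d T; have := double_bin2 #|T|; have : #|T| <= 2 * k by rewrite -cardV max_card.
  move: (\sum_(x in T) _) (#|T|) => S [|t] tk dC sumS; first by rewrite bin0n.
  have := leq_mul (leqnn t) tk; have : k * (v0 \in T) <= k * 1 by rewrite leq_mul2l leq_b1 orbT.
  lia.
- have := sum_d setT; rewrite inE cardsT cardV.
  have -> : \sum_(x in [set: V]) k * (x != v0) = \sum_x k * (x != v0).
    by apply: eq_bigl => x; rewrite inE.
  have := @full_tournament _ D setT fullD; rewrite cardsT cardV arcs_withinT => ->.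
  by have := double_bin2 (2 * k); lia.
by exists O, (fun x => nat_of_bool (x != v0)).
Qed.

(** * From orientations to stars *)

Section Blocks.
Variables (T : eqType) (k : nat) (k0 : 0 < k).
Implicit Types (s : seq T) (x : T).

Definition block s j := take k (drop (j * k) s).

Lemma mem_block s j x : uniq s ->
  (x \in block s j) = (x \in s) && (index x s %/ k == j).
Proof.
move=> us; apply/idP/andP=> [xj|[xs /eqP jE]].
  have xs : x \in s by apply: (mem_drop (n0 := j * k)); apply: mem_take xj.
  split=> //; have /(nthP x)[i] := xj; rewrite size_take_min size_drop leq_min.
  move=> /andP[ik ilt] xE.
  have {}xE : nth x s (j * k + i) = x by rewrite -nth_drop -[RHS]xE nth_take.
  rewrite -{1}xE index_uniq //; last by move: ilt; lia.
  by rewrite divnMDl // divn_small // addn0.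
have := divn_eq (index x s) k; rewrite jE => idx.
have ilt : index x s < size s by rewrite index_mem.
have modk : index x s %% k < k by rewrite ltn_pmod.
have -> : x = nth x (block s j) (index x s %% k).
  by rewrite nth_take // nth_drop -idx nth_index.
apply: mem_nth; rewrite size_take_min size_drop leq_min modk /=.
by rewrite ltn_subRL -idx.
Qed.

Lemma size_block s j c : size s = k * c -> j < c -> size (block s j) = k.
Proof.
move=> sz jc; rewrite size_take_min size_drop sz; apply/minn_idPl.
have := leq_mul (leqnn k) jc; lia.
Qed.
End Blocks.

Local Open Scope fset_scope.

Section Stars.
Implicit Types (S G : graph nat) (X Y : {fset nat}).

Lemma fset2_eq (x y z w : nat) : [fset x; y] = [fset z; w] ->
  (x = z /\ y = w) \/ (x = w /\ y = z).
Proof.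
move=> /fsetP E; have := (E x, E y, E z, E w).
by rewrite !inE !eqxx ?orbT /= => -[[[]]]; lia.
Qed.

Lemma mem_fpairs X (x y : nat) : ([fset x; y] \in fpairs X) = [&& x \in X, y \in X & x != y].
Proof.
rewrite !inE /= fpowersetE fsubUset !fsub1set cardfs2 -andbA.
by case: (x != y); rewrite ?andbT ?andbF.
Qed.

Lemma fpairsP X (e : {fset nat}) : e \in fpairs X ->
  exists x y, [/\ x \in X, y \in X, x != y & e = [fset x; y]].
Proof.
move=> eX; have := eX; rewrite !inE /= => /andP[_ /eqP card_e].
have /fset0Pn[x xe] : e != fset0 by rewrite -cardfs_gt0 card_e.
have /eqP/cardfs1P[y ye] : #|` e `\ x| = 1 by move: card_e; rewrite (cardfsD1 x e) xe => -[].
exists x, y; have eE : e = [fset x; y] by rewrite -(fsetD1K xe) ye.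
by move: eX; rewrite eE mem_fpairs => /and3P[].
Qed.

Lemma subgraph_complete S X : (vertices S `<=` X) -> subgraph S (complete X).
Proof.
move=> sSX; rewrite /subgraph {1}/vertices /= sSX /=.
apply: fsubset_trans (graph_valP S) _; apply/fsubsetP => e /fpairsP[x [y [xS yS xy ->]]].
by rewrite mem_fpairs xy !(fsubsetP sSX).
Qed.

Lemma star_edges_sub (z : nat) Y :
  [fset [fset z; y] | y in Y `\ z] `<=` fpairs (z |` Y).
Proof.
apply/fsubsetP=> e /imfsetP[y /=]; rewrite in_fsetD1 => /andP[yz yY] ->.
by rewrite mem_fpairs !inE eqxx yY orbT eq_sym yz.
Qed.

(** Removing z from Y makes this a simple graph for every z and Y. *)
Definition star_graph (z : nat) Y : graph nat :=
  @Graph nat (z |` Y, [fset [fset z; y] | y in Y `\ z]) (star_edges_sub z Y).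

(** A boolean form of being a star, with its centre exposed, which allows a
    centre to be selected by a computation. *)
Definition centred k z S :=
  [&& z \in vertices S, #|` vertices S `\ z| == k
    & edges S == [fset [fset z; y] | y in vertices S `\ z]].

Lemma star_graphP k z Y : z \notin Y -> #|` Y| = k -> is_star k (star_graph z Y).
Proof.
move=> zY cardY; exists [fset z], Y; split=> //; first by rewrite fdisjoint1X.
  by rewrite cardfs1.
have Yz : Y `\ z = Y by apply/fsetP=> y; rewrite !inE; case: eqP zY => // -> /negPf->.
rewrite /edges /= Yz; apply/fsetP=> e; apply/imfsetP/imfset2P => /=.
  by move=> [y yY ->]; exists z; rewrite ?inE //; exists y.
by move=> [x]; rewrite inE => /eqP-> [y yY ->]; exists y.
Qed.

Lemma star_centred k S : is_star k S -> exists z, centred k z S.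
Proof.
move=> [X [Y [dXY /eqP/cardfs1P[z XE] cardY vS eS]]]; exists z.
have zY : z \notin Y by move: dXY; rewrite XE fdisjoint1X.
have Yz : vertices S `\ z = Y.
  by rewrite vS XE; apply/fsetP=> y; rewrite !inE; case: eqP zY => // -> /negPf->.
rewrite /centred Yz cardY eqxx vS XE !inE eqxx /= eS; apply/eqP/fsetP=> e.
apply/imfset2P/imfsetP => /=.
  by move=> [x]; rewrite XE inE => /eqP-> [y yY ->]; exists y.
by move=> [y yY ->]; exists z; rewrite ?XE ?inE //; exists y.
Qed.

End Stars.

Lemma count_at_most_one (T : eqType) (P : pred T) (s : seq T) : uniq s ->
    {in s &, forall x y, P x -> P y -> x = y} ->
  count P s = has P s.
Proof.
move=> us P1; case: hasP => [[x xs Px]|noP]; last first.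
  by apply/eqP; rewrite -leqn0 leqNgt -has_count; apply/hasP.
have -> : count P s = count_mem x s; last by rewrite count_uniq_mem ?xs.
apply: eq_in_count => y ys /=; apply/idP/eqP=> [Py|-> //].
exact: P1.
Qed.

Lemma card_ord_fset m (Y : {fset nat}) : (forall y, y \in Y -> y < m) ->
  #|[set y : 'I_m | val y \in Y]| = #|` Y|.
Proof.
move=> Ym; rewrite cardE -(size_map val); apply: perm_size; apply: uniq_perm.
- by rewrite map_inj_uniq ?enum_uniq //; apply: val_inj.
- exact: fset_uniq.
move=> y; apply/mapP/idP => [[z]|yY]; first by rewrite mem_enum inE => zY ->.
by exists (Ordinal (Ym y yY)); rewrite // mem_enum inE.
Qed.

Lemma card_ord_lt n m : n <= m -> #|[set x : 'I_m | x < n]| = n.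
Proof.
move=> nm; have := @card_ord_fset m [fset x in iota 0 n].
rewrite (_ : [set y : 'I_m | _] = [set x : 'I_m | x < n]); last first.
  by apply/setP=> x; rewrite !inE mem_iota.
move=> ->; first by rewrite card_fseq undup_id ?iota_uniq // size_iota.
by move=> y; rewrite !inE mem_iota => /andP[_] /leq_trans; apply.
Qed.

Section Bridge.
Variable k : nat.
Implicit Types (S T : graph nat) (A B : {fset graph nat}).

Definition center S := head 0 [seq z <- vertices S | centred k z S].

Lemma centerP S : is_star k S -> centred k (center S) S.
Proof.
move=> /star_centred[z zS]; have zV : z \in vertices S by case/and3P: zS.
have : z \in [seq z <- vertices S | centred k z S] by rewrite mem_filter zS.
rewrite /center; case E: [seq _ <- _ | _] => [//|y l] _.
have : y \in [seq z <- vertices S | centred k z S] by rewrite E mem_head.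
by rewrite mem_filter => /andP[].
Qed.

(** The edges of S directed away from the selected centre. *)
Definition leaf S x y := (x == center S) && (y \in vertices S `\ x).

Lemma mem_star S x y : is_star k S ->
  ([fset x; y] \in edges S) = leaf S x y || leaf S y x.
Proof.
move=> /centerP/and3P[_ _ /eqP->]; rewrite /leaf; apply/imfsetP/orP => /=.
  move=> [w wS /fset2_eq[[-> ->]|[-> ->]]]; [left|right]; by rewrite eqxx.
by case=> /andP[/eqP<- H]; [exists y|exists x] => //; rewrite fsetUC.
Qed.

Lemma leaf_vertices S x y : is_star k S -> leaf S x y ->
  [/\ x \in vertices S, y \in vertices S & x != y].
Proof.
move=> /centerP/and3P[zV _ _] /andP[/eqP-> ]; rewrite in_fsetD1 => /andP[yz yV].
by rewrite eq_sym.
Qed.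

Variables (n m : nat) (A : {fset graph nat}).
Hypothesis nm : n <= m.
Hypothesis hA : partial_star_decomposition k (complete_graph n) A.

Definition covered x y := has (fun S => leaf S x y) A.

Lemma starA S : S \in A -> is_star k S. Proof. by case: hA => H _ /H[]. Qed.

Lemma vertexA S x : S \in A -> x \in vertices S -> x < n.
Proof.
case: hA => H _ /H[_ /andP[/fsubsetP sV _]] /sV.
by rewrite /vertices /= !inE mem_iota.
Qed.

Lemma edgeA S e : S \in A -> e \in edges S -> e \in edges (complete_graph n).
Proof. by case: hA => H _ /H[_ /andP[_ /fsubsetP sE]] /sE. Qed.

Lemma edgeA_inj S T e : S \in A -> T \in A -> e \in edges S -> e \in edges T -> S = T.
Proof.
move=> SA TA eS eT; case: hA => _ H; apply: (H e) => //; exact: edgeA eS.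
Qed.

Lemma covered_lt x y : covered x y -> [/\ x < n, y < n & x != y].
Proof.
case/hasP=> S SA lf; have [xS yS xy] := leaf_vertices (starA SA) lf.
by split=> //; apply: vertexA SA _.
Qed.

Lemma covered_asym x y : covered x y -> ~~ covered y x.
Proof.
case/hasP=> S SA Sxy; apply/negP=> /hasP[T TA Tyx].
have ST : S = T.
  by apply: (@edgeA_inj _ _ [fset x; y]); rewrite ?mem_star ?Sxy ?Tyx ?orbT //; apply: starA.
have [_ _] := leaf_vertices (starA SA) Sxy.
by move: Sxy Tyx; rewrite /leaf -ST => /andP[/eqP-> _] /andP[/eqP-> _]; rewrite eqxx.
Qed.

Definition covered_arcs : {set 'I_m * 'I_m} := [set p : 'I_m * 'I_m | covered p.1 p.2]%SET.
Definition leave_arcs : {set 'I_m * 'I_m} :=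
  [set p : 'I_m * 'I_m | [&& p.1 < p.2, ~~ covered p.1 p.2 & ~~ covered p.2 p.1]]%SET.

Lemma covered_leave_complementary : complementary covered_arcs leave_arcs.
Proof.
move=> x y; rewrite !inE /=; have [->|xy] := eqVneq x y.
  rewrite ltnn; case cyy: (covered y y) => //.
  by have [_ _] := covered_lt cyy; rewrite eqxx.
have : (x < y) || (y < x) by rewrite -neq_ltn.
have := @covered_asym x y; have := @covered_asym y x.
by case: (covered x y); case: (covered y x) => //=; lia.
Qed.

(** By edge-disjointness each covered arc at x belongs to exactly one star
    centred at x, and each such star contributes k of them. *)
Lemma outdeg_covered (x : 'I_m) :
  outdeg covered_arcs x = k * count (fun S => center S == x) A.
Proof.
rewrite outdegE.
rewrite (eq_bigr (fun y : 'I_m => \sum_(S <- A) (leaf S x y : nat))); last first.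
  move=> y _; rewrite inE /= /covered -count_at_most_one ?fset_uniq //.
    by rewrite -sum1_count big_mkcond; apply: eq_bigr => S _; case: leaf.
  move=> S T SA TA Sxy Txy; apply: (@edgeA_inj _ _ [fset val x; val y]) => //.
    by rewrite mem_star ?Sxy //; apply: starA.
  by rewrite mem_star ?Txy //; apply: starA.
rewrite exchange_big -sum1_count big_distrr [RHS]big_mkcond big_seq [RHS]big_seq /=.
apply: eq_bigr => S SA; rewrite /leaf [center S == _]eq_sym muln1.
have [xc|_] := eqVneq (val x) (center S); last by rewrite big1.
have /and3P[_ /eqP cardS _] := centerP (starA SA).
rewrite -xc in cardS; rewrite -[RHS]cardS -(@card_ord_fset m); last first.
  by move=> y; rewrite in_fsetD1 => /andP[_ /(vertexA SA)] /leq_trans; apply.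
by rewrite -sum1_card [RHS]big_mkcond; apply: eq_bigr => y _; rewrite in_set /=; case: (_ \in _).
Qed.

(** The out-neighbours of v are listed and cut into consecutive blocks of size
    k, one new star for each block. An edge covered by A is in no new star; any
    other edge is directed from some v to some w, and the position of w in the
    list of v determines its star. *)
Lemma decomposition_of_orientation (O : {set 'I_m * 'I_m}) (c : 'I_m -> nat) :
    0 < k -> same_edges leave_arcs O -> (forall x, outdeg O x = k * c x) ->
  exists B, star_decomposition k (complete_graph m) B /\ A `<=` B.
Proof.
move=> k0 EO dO.
pose out (v : 'I_m) : seq nat := [seq val w | w <- enum [set w | (v, w) \in O]%SET].
have out_uniq v : uniq (out v) by rewrite map_inj_uniq ?enum_uniq //; apply: val_inj.
have out_size v : size (out v) = k * c v by rewrite size_map -cardE -dO.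
have outP v (w : 'I_m) : (val w \in out v) = ((v, w) \in O).
  by rewrite mem_map ?mem_enum ?inE //; apply: val_inj.
have O_uncovered v w : (v, w) \in O -> [&& v != w, ~~ covered v w, ~~ covered w v & (w, v) \notin O].
  move=> vwO; have [vw|vw] := eqVneq v w.
    by have := EO v w; rewrite -vw in vwO *; rewrite vwO inE /= ltnn.
  have := EO v w; rewrite vwO !inE /=.
  case: (covered v w) => /=; first by rewrite !andbF.
  case: (covered w v) => /=; first by rewrite !andbF.
  by rewrite !andbT; case: (_ \in O) => //; case: (ltngtP v w).
have blockP v j x : x \in block k (out v) j -> exists2 w : 'I_m, x = val w & (v, w) \in O.
  rewrite mem_block // => /andP[/mapP[w + ->] _].
  by rewrite mem_enum inE; exists w.
pose new (v : 'I_m) j := star_graph v [fset x in block k (out v) j].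
have v_block v j : val v \notin [fset x in block k (out v) j].
  apply/negP; rewrite inE => /blockP[w /val_inj <-] /O_uncovered.
  by rewrite eqxx.
have newE v j e : e \in edges (new v j) ->
    exists2 w : 'I_m, val w \in block k (out v) j & e = [fset val v; val w].
  case/imfsetP=> x /=; rewrite in_fsetD1 inE => /andP[_ xb] ->.
  by have [w xw _] := blockP _ _ _ xb; exists w; rewrite -?xw.
pose N := [seq new v j | v <- enum 'I_m, j <- iota 0 (c v)].
have newP S : S \in [fset S in N] -> exists v j, j < c v /\ S = new v j.
  rewrite inE => /allpairsPdep[v [j [_ + ->]]]; rewrite mem_iota => jc.
  by exists v, j.
exists (A `|` [fset S in N]); split; last exact: fsubsetUl.
have vertexK x : (x \in [fset i in iota 0 m]) = (x < m) by rewrite !inE mem_iota.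
split=> [S|e].
  rewrite in_fsetU => /orP[SA|/newP[v [j [jc ->]]]].
    split; first exact: starA.
    apply: subgraph_complete; apply/fsubsetP=> x /(vertexA SA) xn.
    by rewrite vertexK (leq_trans xn).
  split.
    apply: star_graphP; first exact: v_block.
    by rewrite card_fseq undup_id ?take_uniq ?drop_uniq // (size_block k0 (out_size v)).
  apply: subgraph_complete; apply/fsubsetP=> x.
  rewrite in_fset1U vertexK => /orP[/eqP->|]; first exact: ltn_ord.
  by rewrite inE => /blockP[w -> _]; apply: ltn_ord.
move=> /(@fpairsP [fset i in iota 0 m] e)[x [y []]]; rewrite !vertexK => xm ym xy def_e.
pose x' := Ordinal xm; pose y' := Ordinal ym.
have in_new u v (w : 'I_m) : u \in [fset S in N] -> e = [fset val v; val w] ->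
    (v, w) \in O -> e \in edges u -> u = new v (index (val w) (out v) %/ k).
  move=> /newP[v1 [j1 [_ ->]]] e_vw vwO /newE[w1 w1b].
  have := w1b; rewrite mem_block // outP => /andP[vw1O /eqP <-].
  rewrite e_vw => /fset2_eq[[/val_inj-> /val_inj-> //]|[/val_inj vw1 /val_inj wv1]].
  by have /and4P[_ _ _] := O_uncovered _ _ vwO; rewrite vw1 wv1 vw1O.
have disj S u : S \in A -> e \in edges S -> u \in [fset S in N] -> e \in edges u -> False.
  move=> SA eS /newP[v [j [_ ->]]] /newE[w].
  rewrite mem_block // outP => /andP[/O_uncovered/and4P[_ vw wv _] _] e_vw.
  move: eS; rewrite e_vw mem_star; last exact: starA.
  by case/orP=> lf; [case/negP: vw|case/negP: wv]; apply/hasP; exists S.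
have [cov|/norP[ncxy ncyx]] := boolP (covered x y || covered y x).
  have [S SA eS] : exists2 S, S \in A & e \in edges S.
    by case/orP: cov => /hasP[S SA lf]; exists S; rewrite // def_e mem_star ?lf ?orbT //; apply: starA.
  exists S; split; first by rewrite in_fsetU SA.
  move=> u []; rewrite in_fsetU => /orP[uA|uN] eu; first exact: edgeA_inj eS eu.
  by case: (disj S u).
have [v [w [vwO e_vw]]] : exists v w, (v, w) \in O /\ e = [fset val v; val w].
  have := EO x' y'; rewrite !inE /= ncxy ncyx !andbT.
  case xyO: (_ \in O); first by exists x', y'.
  case yxO: (_ \in O); first by exists y', x'; rewrite fsetUC.
  by move: xy; rewrite neq_ltn => /orP[]->; rewrite ?addn1.
have w_out : val w \in out v by rewrite outP.
have idx : index (val w) (out v) %/ k < c v.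
  by rewrite ltn_divLR // mulnC -out_size index_mem.
set j := _ %/ k in idx.
have SN : new v j \in [fset S in N].
  by rewrite inE; apply/allpairsPdep; exists v, j; rewrite mem_enum mem_iota.
have eS : e \in edges (new v j).
  apply/imfsetP; exists (val w) => //=.
  rewrite in_fsetD1 inE mem_block // w_out eqxx andbT.
  by have /and4P[vw _ _ _] := O_uncovered _ _ vwO; rewrite eq_sym andbT.
exists (new v j); split; first by rewrite in_fsetU SN orbT.
move=> u []; rewrite in_fsetU => /orP[uA|uN] eu; first by case: (disj u _ uA eu SN eS).
by rewrite (in_new u v w).
Qed.
End Bridge.

Local Open Scope nat_scope.

(** * The number of new vertices *)

Section Embed.
Variables (k n s : nat) (A : {fset graph nat}).
Hypothesis k1 : 1 < k.
Hypothesis hA : partial_star_decomposition k (complete_graph n) A.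

Lemma star_order_le S : S \in A -> k < n.
Proof.
move=> SA; have /and3P[zV /eqP cardS _] := centerP (starA hA SA).
have := cardfsD1 (center k S) (vertices S); rewrite zV cardS add1n => <-.
have := @card_ord_fset n (vertices S); move=> <-; last by move=> y; apply: (vertexA hA).
by rewrite -[X in _ <= X]card_ord max_card.
Qed.

Lemma embed_decomposition :
    [/\ n <= k & n + s = 2 * k] \/
    [/\ k < n, k %| 'C(n + s, 2), k <= s &
       (4 * k <= n + s /\ s * s <= 8 * k * (s - k)) \/
       [/\ odd k, n + s = 3 * k & 5 * k <= 4 * s]] ->
  exists B, star_decomposition k (complete_graph (n + s)) B /\
    embedding k (complete_graph n) A (complete_graph (n + s)) B.
Proof.
move=> cases.
have k0 : 0 < k by apply: ltnW.
have nm : n <= n + s by apply: leq_addr.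
have CD := covered_leave_complementary nm hA.
suff [O [c [EO dO]]] : star_orientable k (leave_arcs k (n + s) A).
  have [B [dB sAB]] := decomposition_of_orientation nm hA k0 EO dO.
  exists B; split=> //; split=> //; last first.
    apply: subgraph_complete; apply/fsubsetP=> x.
    by rewrite !inE !mem_iota /= => /leq_trans; apply.
  have [starB uniqB] := dB; split=> // e eK S T SB TB eS eT.
  by have [S0 [_ S0u]] := uniqB e eK; rewrite -(S0u S) // -(S0u T).
case: cases => [[nk mk]|[kn kC ks cases]].
  apply: complete_orientation => //; last by rewrite card_ord.
  move=> w v; rewrite eq_sym -CD.
  have cov0 x y : covered k A x y = false.
    by apply/negP=> /hasP[S /star_order_le]; rewrite ltnNge nk.
  by rewrite !inE /= !cov0.
pose U := [set x : 'I_(n + s) | x < n]%SET.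
have cardU : #|U| = n by apply: card_ord_lt.
have cardW : #|~: U| = s by rewrite cardsCs setCK card_ord cardU addKn.
apply: (@leave_orientation _ _ _ U k _ CD _ (outdeg_covered nm hA) k1); rewrite ?cardU ?cardW ?card_ord //.
by apply/subsetP=> -[x y]; rewrite !inE /= => /(covered_lt hA)[-> ->].
Qed.
End Embed.

Lemma window_multiple d n s0 : 0 < d -> exists s, [/\ s0 <= s, s < s0 + d & d %| n + s].
Proof.
move=> d0; exists (s0 + (d - (n + s0) %% d) %% d); split; first exact: leq_addr.
  by rewrite ltn_add2l ltn_pmod.
rewrite addnA /dvdn modnDmr -{1}(modnDml (n + s0)).
by rewrite subnKC ?modnn // ltnW // ltn_pmod.
Qed.

Lemma odd_dvdn_bin2 k m : odd k -> k %| m -> k %| 'C(m, 2).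
Proof.
move=> oddk km; rewrite -(@Gauss_dvdr k 2) ?coprimen2 //.
by rewrite -(dvdn_addl _ km) double_bin2 dvdn_mulr.
Qed.

Lemma double_dvdn_bin2 k m : 2 * k %| m -> k %| 'C(m, 2).
Proof.
move=> km; rewrite -(@dvdn_pmul2l 2) //.
by rewrite -(dvdn_addl _ km) double_bin2 dvdn_mulr.
Qed.

(** For odd k the numbers s of a window of length k starting at 5k/4 satisfy
    the requirement of the greedy choice, as
    (s - (4 - 2 sqrt 2) k) ((4 + 2 sqrt 2) k - s) >= 0 there. *)
Lemma odd_window_arith k s : 5 * k <= 4 * s -> 4 * s < 9 * k -> s * s <= 8 * k * (s - k).
Proof.
move=> s_ge s_lt; have [t st] : exists t, s = k + t by exists (s - k); lia.
have [v tv] : exists v, 4 * t = k + v by exists (4 * t - k); lia.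
have [w vw] : exists w, 4 * k = v + w by exists (4 * k - v); lia.
rewrite st addKn; nia.
Qed.

(** The number t + 1 is (4 - 2 sqrt 2) k rounded up, that is, the least solution
    of s * s + 8 k * k <= 8 k * s. *)
Lemma even_window_start k : 0 < k -> exists t,
  [/\ 8 * k * t < t * t + 8 * k * k, t < 2 * k, k <= t &
  forall i, i < 2 * k -> (t.+1 + i) * (t.+1 + i) <= 8 * k * (t.+1 + i - k)].
Proof.
move=> k0; pose P t := t * t + 8 * k * k <= 8 * k * t.
have exP : exists t, P t by exists (2 * k); rewrite /P; nia.
case: (ex_minnP exP) => -[|t] Pt tmin.
  by move: Pt; rewrite /P; nia.
have Nt : ~~ P t by apply/negP=> /tmin; rewrite ltnn.
have tk : t.+1 <= 2 * k by apply: tmin; rewrite /P; nia.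
exists t; rewrite /P -ltnNge in Nt *; split=> //; rewrite /P in Pt.
  rewrite leqNgt; apply/negP=> tk'; have := leq_mul (leqnn (8 * k)) tk'; nia.
move=> i ik; rewrite mulnBr leq_subRL; last first.
  by rewrite leq_mul2l; apply/orP; right; nia.
have le_8k : 2 * t.+1 + i <= 8 * k by lia.
have := leq_mul (leqnn i) le_8k; nia.
Qed.

Theorem theorem1 (R : realType) (k n : nat) (hk : (2 <= k)%N) (hn : (1 <= n)%N)
    (A : {fset graph nat})
    (hA : partial_star_decomposition k (complete_graph n) A) :
  exists (s : nat) (B : {fset graph nat}),
    [/\ star_decomposition k (complete_graph (n + s)) B,
        embedding k (complete_graph n) A (complete_graph (n + s)) B
      & if odd k then (s%:R < 9 / 4 * k%:R :> R)%R
        else (s%:R < (6 - 2 * Num.sqrt 2) * k%:R :> R)%R].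
Proof.
have k0 : 0 < k by apply: ltnW.
have kR0 : (0 < k%:R :> R)%R by rewrite ltr0n.
have sqrt2_ge0 : (0 <= Num.sqrt 2 :> R)%R by apply: sqrtr_ge0.
have sqr_sqrt2 : (Num.sqrt 2 * Num.sqrt 2 = 2 :> R)%R.
  by rewrite -expr2 sqr_sqrtr ?ler0n.
move: (Num.sqrt 2 : R)%R sqrt2_ge0 sqr_sqrt2 => r r0 r2.
have r_le : (r <= 3 / 2)%R by nra.
suff [s [emb bound]] : exists s,
    ([/\ n <= k & n + s = 2 * k] \/
    [/\ k < n, k %| 'C(n + s, 2), k <= s &
       (4 * k <= n + s /\ s * s <= 8 * k * (s - k)) \/
       [/\ odd k, n + s = 3 * k & 5 * k <= 4 * s]]) /\
    (if odd k then (s%:R < 9 / 4 * k%:R :> R)%R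
     else (s%:R < (6 - 2 * r) * k%:R :> R)%R).
  by have [B [dB eB]] := embed_decomposition hk hA emb; exists s, B.
have [le_nk|lt_kn] := leqP n k.
  (* A star has k + 1 vertices, so A is empty. *)
  exists (2 * k - n); split; first by left; split=> //; lia.
  have : ((2 * k - n)%:R < 2 * k%:R :> R)%R by rewrite -natrM ltr_nat; lia.
  by case: (odd k); nra.
case: (boolP (odd k)) => oddk.
  (* (5k + 3) / 4 is 5k / 4 rounded up. *)
  have [s [s_ge s_lt /dvdnP[j ms]]] := window_multiple n ((5 * k + 3) %/ 4) k0.
  have {}s_ge : 5 * k <= 4 * s by lia.
  have {}s_lt : 4 * s < 9 * k by lia.
  exists s; split; last first.
    have : ((4 * s)%:R < (9 * k)%:R :> R)%R by rewrite ltr_nat.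
    by rewrite !natrM; lra.
  right; split=> //; [| lia |].
    by apply: odd_dvdn_bin2; rewrite // ms dvdn_mull.
  have j3 : 2 < j.
    by rewrite ltnNge; apply/negP=> j2; have := leq_mul j2 (leqnn k); lia.
  have [j4|] := leqP 4 j.
    left; split; last exact: odd_window_arith.
    by rewrite ms leq_mul2r j4 orbT.
  by move=> j4; right; split=> //; rewrite ms; congr (_ * _); lia.
have [t [Nt tk kt win]] := even_window_start k0.
have dk0 : 0 < 2 * k by rewrite muln_gt0.
have [s [s_ge s_lt /dvdnP[j ms]]] := window_multiple n t.+1 dk0.
exists s; split.
  right; split=> //; [|lia|].
    by apply: double_dvdn_bin2; rewrite ms dvdn_mull.
  left; split; last first.
    by have := win (s - t.+1); rewrite subnKC //; apply; lia.
  have j2 : 1 < j.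
    by rewrite ltnNge; apply/negP=> j1; have := leq_mul j1 (leqnn (2 * k)); lia.
  by rewrite ms; have := leq_mul j2 (leqnn (2 * k)); lia.
have : ((8 * k * t)%:R < (t * t + 8 * k * k)%:R :> R)%R by rewrite ltr_nat.
have : (s%:R <= (t + 2 * k)%:R :> R)%R by rewrite ler_nat; lia.
have : (t%:R < (2 * k)%:R :> R)%R by rewrite ltr_nat.
rewrite !natrD !natrM; move: (s%:R)%R (t%:R)%R (k%:R)%R kR0 => s' t' k' kR0 H1 H2 H3.
rewrite ltNge; apply/negP=> H4.
(* Otherwise 4k - t <= 2 r k, against (4k - t)^2 > 8 k^2. *)
have H5 : (0 <= (2 * r * k' - (4 * k' - t')) * (2 * r * k' + (4 * k' - t')))%R.
  by apply: mulr_ge0; nra.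
nra.
Qed.
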